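(* Let $[b_1,b_2,\ldots,b_m]$ be an even continued fraction ($m\ge 1$), let $V_{[b_1,\ldots,b_m]}$ be the Jones polynomial of the corresponding oriented 2-bridge link $C[b_1,\ldots,b_m]$, and let $F_{b_1,\ldots,b_m}$ be the specialized $F$-polynomial. Then $$V_{[b_1,b_2,\ldots,b_m]}=(-1)^{m-\tau}\,t^{j}\,F_{b_1,b_2,\ldots,b_m},$$ where $\tau$ is the number of (consecutive) subsequences $+,+$ in the type sequence of $[b_1,\ldots,b_m]$ and $$j=\sum_{i=1}^m\max\left((-1)^{i+1}b_i+\frac{\operatorname{sign}(b_ib_{i-1})}{2}\ ,\ -\frac12\right),$$ with the convention $\operatorname{sign}(b_0)=1$, i.e. $\operatorname{sign}(b_1b_0)=\operatorname{sign}(b_1)$.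
   Context: CONTINUED FRACTIONS. $[c_1,\ldots,c_k]=c_1+1/(c_2+1/(\cdots+1/c_k))$. It is even if every $c_i$ is a nonzero even integer, and positive if every $c_i$ is a positive integer. The type sequence of an even continued fraction $[b_1,\ldots,b_m]$ is $(\operatorname{sgn}(b_1),-\operatorname{sgn}(b_2),\ldots,(-1)^{m+1}\operatorname{sgn}(b_m))$. THE LINK $C[b_1,\ldots,b_m]$. It is the oriented 2-bridge link with Conway diagram consisting of $m$ successive 2-strand braids, the $i$-th having $|b_i|$ crossings; the diagram alternates from the $i$-th to the $(i+1)$-st braid iff $b_i,b_{i+1}$ have the same sign, and it is oriented so that all crossings of the $i$-th braid have sign $(-1)^{i+1}\operatorname{sgn}(b_i)$. Concretely: take four horizontal strands in positions $1,2,3,4$ and, from left to right, the braid $\sigma_2^{-b_1}\sigma_1^{b_2}\sigma_2^{-b_3}\cdots$ ($i$-th factor $\sigma_2^{-b_i}$ for $i$ odd, $\sigma_1^{b_i}$ for $i$ even), where $\sigma_j$ crosses the strands in positions $j,j+1$ by a crossing that is positive when both strands are oriented left to right. On the left join ends $1$–$2$ and $3$–$4$; on the right join $1$–$2$ and $3$–$4$ if $m$ is odd, and $2$–$3$ and $1$–$4$ (nested arcs) if $m$ is even. Since all $b_i$ are even the braid is pure; orient the strands with ends in positions $1,3$ left to right and those in positions $2,4$ right to left. JONES POLYNOMIAL. $V(\text{unknot})=1$ and $t^{-1}V(L_+)-t\,V(L_-)+(t^{-1/2}-t^{1/2})V(L_0)=0$ for oriented links $L_+,L_-,L_0$ that agree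 except near one point, where they have a positive crossing, a negative crossing, and the oriented smoothing respectively. $V_{[b_1,\ldots,b_m]}=V(C[b_1,\ldots,b_m])$. SPECIALIZED $F$-POLYNOMIALS. Let $[a_1,\ldots,a_n]$ be a positive continued fraction, $\ell_0=0$, $\ell_i=a_1+\cdots+a_i$, $d=\ell_n-1$. Let $Q$ be the quiver of type $\mathbb A_d$ with vertices $1,\ldots,d$ having, for each $1\le i<d$ with $\ell_{k-1}\le i<\ell_k$, exactly one arrow between $i$ and $i+1$: $i+1\to i$ if $k$ is odd, $i\to i+1$ if $k$ is even. Let $F[a_1,\ldots,a_n]\in\mathbb Z[y_1,\ldots,y_d]$ be the $F$-polynomial (all initial cluster variables $x_i$ set to $1$) of the cluster variable with denominator $x_1x_2\cdots x_d$ in the cluster algebra with principal coefficients of initial quiver $Q$ (the cluster variable whose snake graph is that of $[a_1,\ldots,a_n]$); equivalently $F[a_1,\ldots,a_n]=\sum_S\prod_{i\in S}y_i$, summed over all subsets $S\subseteq\{1,\ldots,d\}$ such that $i\in S$ and $i\to j$ in $Q$ imply $j\in S$. Let $F_{a_1,\ldots,a_n}$ be the specialization of $F[a_1,\ldots,a_n]$ at $y_1=t^{-2}$, $y_i=-t^{-1}$ for $i>1$. For an even continued fraction $[b_1,\ldots,b_m]$ with value $r/s$, let $[a_1,\ldots,a_n]$ be the positive continued fraction of $|r/s|$ and $d=a_1+\cdots+a_n-1$; then $F_{b_1,\ldots,b_m}:=F_{a_1,\ldots,a_n}$ if $b_1>0$, and $F_{b_1,\ldots,b_m}:=(-t^{-1})^{d+1}\,\overline{F_{a_1,\ldots,a_n}}$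 if $b_1<0$, where the bar is the ring automorphism $t^{1/2}\mapsto t^{-1/2}$. *)

(* Defs.v *)
From HB Require Import structures.
From Stdlib Require Import Relation_Operators.
From mathcomp Require Import all_boot all_order all_algebra.
From mathcomp Require Import mpoly.

Set Implicit Arguments.
Unset Strict Implicit.
Unset Printing Implicit Defensive.

Import Order.TTheory GRing.Theory Num.Theory.
Local Open Scope ring_scope.

(** * Laurent polynomials in [t^(1/2)]

    They are represented inside the fraction field Q(t^(1/2)), which contains
    Z[t^(1/2), t^(-1/2)]; the indeterminate ['X] is [t^(1/2)]. *)

Notation ratfun := {fraction {poly int}}.

Definition sqrt_t : ratfun := FracField.tofrac 'X.
Definition t : ratfun := sqrt_t ^+ 2.

(** [t ^ q] for [q] in (1/2)Z: then [2 * q] is an integer, hence equal to its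
    own numerator. *)
Definition t_pow (q : rat) : ratfun := sqrt_t ^ numq (2%:R * q).

(** The extension of a ring morphism [f] to fractions, computed on a
    representative. It is a ring morphism as soon as [f] is injective. *)
Definition frac_lift (R : idomainType) (F : fieldType) (f : R -> F)
  (x : {fraction R}) : F := f (\n_(repr x)) / f (\d_(repr x)).

Lemma repr_numden (R : idomainType) (x : {fraction R}) :
  x * FracField.tofrac (\d_(repr x)) = FracField.tofrac (\n_(repr x)).
Proof.
have d0 := denom_ratioP (repr x).
unlock FracField.tofrac; rewrite -{1}[x]reprK -[LHS]FracField.pi_mul.
apply/eqmodP; rewrite /= FracField.equivfE /FracField.mulf.
by rewrite !numden_Ratio ?mulf_neq0 ?oner_eq0 // !mulr1 mulrC.
Qed.

Lemma frac_liftE (R : idomainType) (F : fieldType) (f : {rmorphism R -> F})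
    (x : {fraction R}) (p q : R) :
  (forall r, (f r == 0) = (r == 0)) -> q != 0 ->
  x * FracField.tofrac q = FracField.tofrac p -> frac_lift f x = f p / f q.
Proof.
move=> f0 q0 xq; have xd := repr_numden x; have d0 := denom_ratioP (repr x).
rewrite /frac_lift; move: (\n_ _) (\d_ _) xd d0 => n d xd d0.
apply/eqP; rewrite eqr_div ?f0 // -!rmorphM; apply/eqP; congr (f _).
by apply/eqP; rewrite -tofrac_eq !tofracM -xd -xq mulrAC.
Qed.

Lemma frac_lift_is_zmod_morphism (R : idomainType) (F : fieldType)
    (f : {rmorphism R -> F}) :
  (forall r, (f r == 0) = (r == 0)) -> zmod_morphism (frac_lift f).
Proof.
move=> f0 x y; have xd := repr_numden x; have yd := repr_numden y.
have dx := denom_ratioP (repr x); have dy := denom_ratioP (repr y).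
rewrite {2 3}/frac_lift.
move: (\n_(repr x)) (\d_(repr x)) xd dx => n d xd dx.
move: (\n_(repr y)) (\d_(repr y)) yd dy => n' d' yd dy.
rewrite (@frac_liftE _ _ _ _ (n * d' - n' * d) (d * d')) ?mulf_neq0 //.
  by rewrite rmorphB !rmorphM -mulNr -[in RHS]mulNr addf_div ?f0.
rewrite tofracB !tofracM -xd -yd mulrBl mulrA.
by congr (_ - _); rewrite mulrCA mulrC.
Qed.

Lemma frac_lift_is_monoid_morphism (R : idomainType) (F : fieldType)
    (f : {rmorphism R -> F}) :
  (forall r, (f r == 0) = (r == 0)) -> monoid_morphism (frac_lift f).
Proof.
move=> f0; split.
  rewrite (@frac_liftE _ _ _ _ 1 1) ?oner_neq0 ?mul1r //.
  by rewrite !rmorph1 invr1 mulr1.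
move=> x y; have xd := repr_numden x; have yd := repr_numden y.
have dx := denom_ratioP (repr x); have dy := denom_ratioP (repr y).
rewrite {2 3}/frac_lift.
move: (\n_(repr x)) (\d_(repr x)) xd dx => n d xd dx.
move: (\n_(repr y)) (\d_(repr y)) yd dy => n' d' yd dy.
rewrite (@frac_liftE _ _ _ _ (n * n') (d * d')) ?mulf_neq0 //.
  by rewrite !rmorphM mulf_div.
by rewrite !tofracM -xd -yd mulrACA.
Qed.

Lemma frac_lift_tofrac (R : idomainType) (F : fieldType)
    (f : {rmorphism R -> F}) (p : R) :
  (forall r, (f r == 0) = (r == 0)) -> frac_lift f (FracField.tofrac p) = f p.
Proof.
move=> f0; rewrite (@frac_liftE _ _ _ _ p 1) ?oner_neq0 //.
  by rewrite rmorph1 divr1.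
by rewrite tofrac1 mulr1.
Qed.

(** The ring automorphism t^(1/2) |-> t^(-1/2). *)
Definition bar_poly (p : {poly int}) : ratfun := (map_poly intr p).[sqrt_t^-1].
Definition bar : ratfun -> ratfun := frac_lift bar_poly.

Lemma sqrt_t_neq0 : sqrt_t != 0.
Proof. by rewrite tofrac_eq0 polyX_eq0. Qed.

Lemma bar_poly_is_zmod_morphism : zmod_morphism bar_poly.
Proof. by move=> p q; rewrite /bar_poly rmorphB hornerD hornerN. Qed.

Lemma bar_poly_is_monoid_morphism : monoid_morphism bar_poly.
Proof.
split; first by rewrite /bar_poly rmorph1 hornerC.
by move=> p q; rewrite /bar_poly rmorphM hornerM.
Qed.

HB.instance Definition _ := GRing.isZmodMorphism.Build {poly int} ratfun
  bar_poly bar_poly_is_zmod_morphism.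
HB.instance Definition _ := GRing.isMonoidMorphism.Build {poly int} ratfun
  bar_poly bar_poly_is_monoid_morphism.

Lemma tofracC (c : int) : FracField.tofrac c%:P = c%:~R :> ratfun.
Proof. by rewrite -[c in LHS]intz !rmorph_int. Qed.

Lemma bar_poly_eq0 p : (bar_poly p == 0) = (p == 0).
Proof.
apply/idP/idP => [/eqP p0|/eqP->]; last by rewrite rmorph0.
pose n := size p; pose q := \poly_(i < n) p`_(n - i.+1).
have q0 : q = 0.
  apply/eqP; rewrite -tofrac_eq0.
  suff -> : FracField.tofrac q = sqrt_t ^+ n.-1 * bar_poly p by rewrite p0 mulr0.
  rewrite /bar_poly (@horner_coef_wide _ n) ?size_poly //.
  rewrite /q poly_def rmorph_sum mulr_sumr (reindex_inj rev_ord_inj) /=.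
  apply: eq_bigr => i _; have lt_in := ltn_ord i.
  have le_in : (i <= n.-1)%N by rewrite -ltnS (ltn_predK lt_in).
  rewrite coef_map /= subnSK // subKn 1?ltnW // -mul_polyC.
  rewrite rmorphM rmorphXn /= -/sqrt_t.
  have -> : (n - i.+1 = n.-1 - i)%N by rewrite subnS -subn1 subnAC subn1.
  rewrite -[in RHS](subnK le_in) exprD exprVn mulrCA mulfK ?expf_neq0 ?sqrt_t_neq0 //.
  by rewrite tofracC.
apply/eqP/polyP => i; rewrite coef0.
have [lt_in|] := ltnP i n; last by move/(nth_default 0).
have /(congr1 (fun r : {poly int} => r`_(n - i.+1))) := q0.
rewrite coef0 coef_poly ltn_subrL (leq_ltn_trans _ lt_in) //=.
by rewrite subnSK // subKn // ltnW.
Qed.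

HB.instance Definition _ := GRing.isZmodMorphism.Build ratfun ratfun
  bar (frac_lift_is_zmod_morphism bar_poly_eq0).
HB.instance Definition _ := GRing.isMonoidMorphism.Build ratfun ratfun
  bar (frac_lift_is_monoid_morphism bar_poly_eq0).

Lemma bar_tofrac p : bar (FracField.tofrac p) = bar_poly p.
Proof. exact: frac_lift_tofrac bar_poly_eq0. Qed.

Lemma bar_sqrt_t : bar sqrt_t = sqrt_t^-1.
Proof. by rewrite bar_tofrac /bar_poly map_polyX hornerX. Qed.

Lemma barK : involutive bar.
Proof.
have barFK (p : {poly int}) : bar (bar_poly p) = FracField.tofrac p.
  rewrite {1}/bar_poly (@horner_coef_wide _ (size p)) ?size_poly //.
  rewrite rmorph_sum /= -[in RHS](coefK p) poly_def rmorph_sum /=.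
  apply: eq_bigr => i _; rewrite coef_map /= -mul_polyC.
  rewrite (rmorphM bar) (rmorphXn bar) fmorphV /= bar_sqrt_t invrK rmorph_int.
  by rewrite tofracM tofracXn tofracC.
move=> x; have xd := repr_numden x; have dx := denom_ratioP (repr x).
rewrite -tofrac_eq0 in dx.
rewrite {2}/bar /frac_lift (rmorphM bar) fmorphV /= !barFK -xd.
by rewrite (mulfK dx).
Qed.

(** * Oriented link diagrams

    A diagram in the plane in general position is read from left to right and
    cut into elementary slices.  A slice [(i, e)] applies the elementary piece
    [e] to the strands in positions [i], [i + 1], counted from 0:
    - [Cup o] creates two strands joined on their left; the first one is
      oriented left to right iff [o] is [true], and the second one oppositely;
    - [Cap] joins the two strands on their right;
    - [Cross e] is the braid generator sigma if [e], its inverse otherwise,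
      where sigma is a positive crossing as soon as both strands are oriented
      left to right. *)

Inductive piece := Cup of bool | Cap | Cross of bool.

Definition slice := (nat * piece)%type.
Definition diagram := seq slice.

(** The state between two slices lists the orientations of the strands,
    [true] meaning left to right. *)
Definition slice_step (s : slice) (w : seq bool) : option (seq bool) :=
  let: (i, e) := s in
  match e with
  | Cup o =>
      if (i <= size w)%N then Some (take i w ++ [:: o, ~~ o & drop i w])
      else None
  | Cap =>
      if drop i w is o1 :: o2 :: w' then
        if o1 != o2 then Some (take i w ++ w') else None
      else None
  | Cross _ =>
      if drop i w is o1 :: o2 :: w' then Some (take i w ++ [:: o2, o1 & w'])
      else None
  end.

Fixpoint run (D : diagram) (w : seq bool) : option (seq bool) :=
  if D is s :: D' then obind (run D') (slice_step s w) else Some w.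

(** The well-formed diagrams of (closed) oriented links. *)
Definition link_diagram (D : diagram) : bool := run D [::] == Some [::].

Definition arity_in (e : piece) : nat := (if e is Cup _ then 0 else 2)%N.
Definition arity_out (e : piece) : nat := (if e is Cap then 0 else 2)%N.

(** Local moves: planar isotopy (exchange of distant slices, straightening of
    a zigzag, rotation of a crossing past a cap or a cup) and the three
    Reidemeister moves.  Together with their inverses they generate isotopy of
    links presented by sliced diagrams; the crossings carry no orientation, so
    that each move covers all orientations of the strands. *)
Inductive local_move : diagram -> diagram -> Prop :=
| Exchange i k e f :
    local_move [:: (i + arity_in e + k, f); (i, e)]%N
               [:: (i, e); (i + arity_out e + k, f)]%N
| Zigzag_up i o : local_move [:: (i, Cup o); (i.+1, Cap)] [::]
| Zigzag_down i o : local_move [:: (i.+1, Cup o); (i, Cap)] [::]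
| Rotate_cap i e :
    local_move [:: (i, Cross e); (i.+1, Cap)]
               [:: (i.+1, Cross (~~ e)); (i, Cap)]
| Rotate_cup i e o :
    local_move [:: (i.+1, Cup o); (i, Cross e)]
               [:: (i, Cup o); (i.+1, Cross (~~ e))]
| Reidemeister1_cap i e : local_move [:: (i, Cross e); (i, Cap)] [:: (i, Cap)]
| Reidemeister1_cup i e o :
    local_move [:: (i, Cup o); (i, Cross e)] [:: (i, Cup (~~ o))]
| Reidemeister2 i e : local_move [:: (i, Cross e); (i, Cross (~~ e))] [::]
| Reidemeister3 i e :
    local_move [:: (i, Cross e); (i.+1, Cross e); (i, Cross e)]
               [:: (i.+1, Cross e); (i, Cross e); (i.+1, Cross e)].

Inductive diagram_move : diagram -> diagram -> Prop :=
| DiagramMove A B D D' :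
    local_move D D' ->
    link_diagram (A ++ D ++ B) -> link_diagram (A ++ D' ++ B) ->
    diagram_move (A ++ D ++ B) (A ++ D' ++ B).

Definition isotopic : diagram -> diagram -> Prop :=
  clos_refl_sym_trans diagram diagram_move.

(** * The Jones polynomial *)

Definition unknot : diagram := [:: (0, Cup true); (0, Cap)]%N.

(** Reversing one of the two strands changes the sign of a crossing: with
    strands entering with orientations [o1] and [o2], [Cross e] is a positive
    crossing iff [e == (o1 == o2)]. *)
Definition pos_crossing (i : nat) (o1 o2 : bool) : slice :=
  (i, Cross (o1 == o2)).
Definition neg_crossing (i : nat) (o1 o2 : bool) : slice :=
  (i, Cross (o1 != o2)).

(** The oriented smoothing: two antiparallel strands are turned back. *)
Definition smoothing (i : nat) (o1 o2 : bool) : diagram :=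
  if o1 == o2 then [::] else [:: (i, Cap); (i, Cup o2)].

(** [V] is the Jones polynomial, i.e. the isotopy invariant of oriented links
    determined by its value on the unknot and by the skein relation.  Values
    of [V] outside of [link_diagram] are irrelevant. *)
Record jones_polynomial (V : diagram -> ratfun) : Prop := JonesPolynomial {
  jones_isotopy : forall D D', isotopic D D' -> V D = V D';
  jones_unknot : V unknot = 1;
  jones_skein : forall (A B : diagram) (i : nat) (w w' : seq bool) (o1 o2 : bool),
    run A [::] = Some w -> drop i w = [:: o1, o2 & w'] ->
    link_diagram (A ++ [:: pos_crossing i o1 o2] ++ B) ->
    t^-1 * V (A ++ [:: pos_crossing i o1 o2] ++ B)
    - t * V (A ++ [:: neg_crossing i o1 o2] ++ B)
    + (sqrt_t^-1 - sqrt_t) * V (A ++ smoothing i o1 o2 ++ B) = 0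
}.

(** * Continued fractions *)

(** [[c_1, ..., c_k]]; since [0^-1 = 0], the value of [[c_k]] is [c_k]. *)
Fixpoint cf_val (c : seq int) : rat :=
  if c is x :: c' then x%:~R + (cf_val c')^-1 else 0.

Definition even_cf (b : seq int) : bool :=
  (b != [::]) && all (fun x => (x != 0) && (2 %| x)%Z) b.

Definition positive_cf (a : seq nat) : bool :=
  (a != [::]) && all (fun x => 0 < x)%N a.

(** In the sequel the 1-based [b_i] is [b`_(i - 1)], so signs [(-1)^(i+1)]
    become [(-1) ^+ (i - 1)]. *)
Definition type_seq (b : seq int) : seq int :=
  mkseq (fun i => (-1) ^+ i * sgz b`_i) (size b).

Definition tau (b : seq int) : nat :=
  count (fun i => ((type_seq b)`_i == 1) && ((type_seq b)`_i.+1 == 1))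
        (iota 0 (size b).-1).

(** [(1 :: b)`_i] is the entry preceding [b`_i], with [b_0 := 1] of sign 1. *)
Definition jexp (b : seq int) : rat :=
  \sum_(i < size b)
    Num.max (((-1) ^+ i * b`_i)%:~R + (sgz (b`_i * (1 :: b)`_i))%:~R / 2%:R)
            (- (1 / 2%:R)).

(** * The 2-bridge link of a continued fraction *)

(** [sigma_j ^ z], on the strands in positions [j], [j + 1] counted from 1. *)
Definition sigma_pow (j : nat) (z : int) : diagram :=
  nseq `|z|%N (j.-1, Cross (0 <= z)).

Definition two_bridge_braid (b : seq int) : diagram :=
  flatten (mkseq (fun i => if odd i then sigma_pow 1 b`_i
                           else sigma_pow 2 (- b`_i)) (size b)).

Definition two_bridge (b : seq int) : diagram :=
  [:: (0, Cup true); (2, Cup true)]%N ++ two_bridge_braid b ++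
  (if odd (size b) then [:: (0, Cap); (0, Cap)] else [:: (1, Cap); (0, Cap)])%N.

Lemma run_cat A B w : run (A ++ B) w = obind (run B) (run A w).
Proof. by elim: A w => //= s A IH w; case: (slice_step s w). Qed.

Lemma two_bridge_link_diagram b : even_cf b -> link_diagram (two_bridge b).
Proof.
case/andP=> _ /allP b_even; rewrite /link_diagram.
pose w0 := [:: true; false; true; false].
suff braid_pure : run (two_bridge_braid b) w0 = Some w0.
  rewrite /two_bridge run_cat /= -/w0 run_cat braid_pure /=.
  by case: (odd _).
have sigma_pure j x : (2 %| x)%Z -> (0 < j < 3)%N ->
    run (sigma_pow j x) w0 = Some w0.
  rewrite dvdzE /sigma_pow => /dvdnP[k ->] j_bnd.
  by elim: k => [//|k IH]; rewrite mulSn; case: j j_bnd IH => [|[|[|]]].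
have flatten_pure n (f : nat -> diagram) :
    (forall i, (i < n)%N -> run (f i) w0 = Some w0) ->
    run (flatten (mkseq f n)) w0 = Some w0.
  elim: n => [//|n IH] pure_f; rewrite mkseqS flatten_rcons run_cat IH.
    by rewrite /= pure_f.
  by move=> i lt_in; rewrite pure_f // ltnW.
apply: flatten_pure => i lt_i.
have /b_even/andP[_ bi_even] := mem_nth 0 lt_i.
by case: odd; apply: sigma_pure; rewrite ?dvdzE ?abszN -?dvdzE.
Qed.

(** * Specialized F-polynomials *)

Definition ell (a : seq nat) (k : nat) : nat := sumn (take k a).

(** The arrows of the quiver, between vertices numbered from 1; the index [k]
    below is [k - 1] in the usual 1-based numbering of [a]. *)
Definition arrow (a : seq nat) (i j : nat) : bool :=
  [exists k : 'I_(size a),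
     if odd k then (j == i.+1) && (ell a k <= i < ell a k.+1)%N
     else (i == j.+1) && (ell a k <= j < ell a k.+1)%N].

Definition quiver_rank (a : seq nat) : nat := (sumn a).-1.

(** [x : 'I_(quiver_rank a)] stands for the vertex [x.+1]. *)
Definition closed_subset (a : seq nat) (S : {set 'I_(quiver_rank a)}) : bool :=
  [forall x in S, forall y : 'I_(quiver_rank a),
     arrow a x.+1 y.+1 ==> (y \in S)].

(** The F-polynomial of the cluster variable with denominator x_1 ... x_d, as
    the generating function of the subsets of vertices closed under the arrows
    of the quiver. *)
Definition F_poly (a : seq nat) : {mpoly int[quiver_rank a]} :=
  \sum_(S : {set 'I_(quiver_rank a)} | closed_subset S) \prod_(x in S) 'X_x.

Definition F_spec (a : seq nat) : ratfun :=
  mmap intr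
    (fun x : 'I_(quiver_rank a) => if val x == 0%N then t ^- 2 else - t^-1)
    (F_poly a).

(** [F_{b_1, ..., b_m}], where [a] is the positive continued fraction of the
    absolute value of [[b_1, ..., b_m]]. *)
Definition F_even (b : seq int) (a : seq nat) : ratfun :=
  if 0 < b`_0 then F_spec a
  else (- t^-1) ^+ (quiver_rank a).+1 * bar (F_spec a).

(* Main.v *)
From Stdlib Require Import Relation_Operators.
Require Import Defs.
From mathcomp Require Import all_boot all_order all_algebra.
From mathcomp Require Import mpoly.
From mathcomp Require Import ring lra zify.
Import GRing.Theory Num.Theory.
Local Open Scope ring_scope.
Import Order.TTheory.

Set Implicit Arguments.
Unset Strict Implicit.
Unset Printing Implicit Defensive.

(** Put c_i = (-1)^(i+1) b_i (1-based), s = t^(1/2) and delta = -(s + 1/s). Every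
    crossing of the i-th braid has sign sgn(c_i), and its oriented smoothing cuts
    the link down to C[b_1, ..., b_(i-1)]. Solving the skein relation in the last
    entry gives, with V_0 = 1 and V_(-1) = delta,
      V_m = t^(c_m) V_(m-2) + (1 - t^(c_m)) / delta * V_(m-1).
    Read from the front, this is the recursion of the q-deformed continued
    fraction c_1 - 1/(c_2 - 1/(c_3 - ...)) at q = -1/t.  The numerators and
    denominators of q-rationals are computed along the Stern-Brocot word of a
    rational, the same word being read off either continued fraction, and
    F = q R + (1 - q) S for the q-rational R/S of the value of [a_1, ..., a_n].
    Keeping track of the monomial factor at each step yields the sign and j. *)

(** * Skein recursion of two-bridge links *)

Definition std_state := [:: true; false; true; false].
Definition cups : diagram := [:: (0, Cup true); (2, Cup true)]%N.
(** With [o := odd m], the right-hand ends of a diagram with [m] braids; the braid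
    after these is on the strands in positions [braid_pos o], [braid_pos o + 1]. *)
Definition closure (o : bool) : diagram :=
  if o then [:: (0, Cap); (0, Cap)]%N else [:: (1, Cap); (0, Cap)]%N.
Definition braid_pos (o : bool) : nat := if o then 0 else 1.

Lemma jones_move V A B D D' : jones_polynomial V -> local_move D D' ->
  link_diagram (A ++ D ++ B) -> link_diagram (A ++ D' ++ B) ->
  V (A ++ D ++ B) = V (A ++ D' ++ B).
Proof.
by move=> VJ mv l1 l2; apply: (jones_isotopy VJ); apply: rst_step; constructor.
Qed.

Lemma step_cross p u v o1 o2 e : size u = p ->
  slice_step (p, Cross e) (u ++ [:: o1, o2 & v]) = Some (u ++ [:: o2, o1 & v]).
Proof. by move=> <-; rewrite /= drop_size_cat // take_size_cat. Qed.

Lemma step_cap p u v o1 o2 : size u = p ->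
  slice_step (p, Cap) (u ++ [:: o1, o2 & v]) =
  if o1 != o2 then Some (u ++ v) else None.
Proof. by move=> <-; rewrite /= drop_size_cat // take_size_cat. Qed.

Lemma run_cons x D w : run (x :: D) w = obind (run D) (slice_step x w).
Proof. by []. Qed.

Lemma run_crosses p n e u v o1 o2 : size u = p ->
  run (nseq n (p, Cross e)) (u ++ [:: o1, o2 & v]) =
  Some (u ++ if odd n then [:: o2, o1 & v] else [:: o1, o2 & v]).
Proof.
move=> sp; elim: n o1 o2 => [//|n IH] o1 o2.
by rewrite [nseq _ _]/= run_cons step_cross //= IH; case: (odd n).
Qed.

(** Reidemeister 1 absorbs the crossings into the cup one at a time, and each absorption reverses
    the cup, whence the parity of [n]. *)
Lemma jones_curls_cup V A B p n e o : jones_polynomial V ->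
  link_diagram (A ++ (p, Cup o) :: nseq n (p, Cross e) ++ B) ->
  V (A ++ (p, Cup o) :: nseq n (p, Cross e) ++ B) =
  V (A ++ (p, Cup (odd n (+) o)) :: B).
Proof.
move=> VJ; elim: n o => [//|n IH] o L.
have L' : link_diagram (A ++ (p, Cup (~~ o)) :: nseq n (p, Cross e) ++ B).
  move: L; rewrite /link_diagram !run_cat; case: (run A [::]) => [w|] //.
  rewrite /= ; case: leqP => // le_pw.
  have sp : size (take p w) = p by rewrite size_takel.
  by have := @step_cross p _ (drop p w) o (~~ o) e sp; rewrite /= => ->; rewrite negbK.
rewrite [odd _]/= addNb -addbN.
rewrite -IH //.
exact: (@jones_move _ A _ [:: (p, Cup o); (p, Cross e)] [:: (p, Cup (~~ o))] VJ
  (Reidemeister1_cup _ _ _)).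
Qed.

Lemma jones_curls_cap V A B p n e : jones_polynomial V ->
  link_diagram (A ++ nseq n (p, Cross e) ++ (p, Cap) :: B) ->
  V (A ++ nseq n (p, Cross e) ++ (p, Cap) :: B) = V (A ++ (p, Cap) :: B).
Proof.
move=> VJ; elim: n => [//|n IH]; rewrite -addn1 nseqD -catA /= => L.
have L' : link_diagram (A ++ nseq n (p, Cross e) ++ (p, Cap) :: B).
  move: L; rewrite /link_diagram !run_cat; case: (run A [::]) => [w|] //.
  rewrite ![obind _ (Some w)]/= !run_cat; case: (run _ w) => [w'|] //.
  rewrite ![obind _ (Some w')]/= /=; case E: (drop p w') => [|o1 [|o2 v]] //=.
  have sp : size (take p w') = p.
    rewrite size_takel // leqNgt; apply/negP=> lt.
    by move: E; rewrite drop_oversize // ltnW.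
  have := @step_cap p _ v o2 o1 sp; rewrite /= => ->.
  by rewrite (eq_sym o2); case: (o1 != o2).
rewrite -IH // !catA.
apply: (@jones_move _ _ B [:: (p, Cross e); (p, Cap)] [:: (p, Cap)]) => //.
- exact: Reidemeister1_cap.
- by rewrite -catA.
- by rewrite -catA.
Qed.

Lemma tofrac_monic_neq0 (p : {poly int}) : p \is monic -> FracField.tofrac p != 0.
Proof. by rewrite tofrac_eq0; apply: monic_neq0. Qed.

Lemma sqrt_t_sqr_sub1_neq0 : sqrt_t ^+ 2 - 1 != 0.
Proof.
rewrite -tofracXn -tofrac1 -tofracB; apply: tofrac_monic_neq0.
exact: monicXnsubC.
Qed.

Lemma sqrt_t_sqr_add1_neq0 : sqrt_t ^+ 2 + 1 != 0.
Proof.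
rewrite -tofracXn -tofrac1 -tofracD; apply: tofrac_monic_neq0.
exact: monicXnaddC.
Qed.

Lemma skein_unlink (K : fieldType) (s U : K) : s != 0 -> s ^+ 2 - 1 != 0 ->
  (s ^+ 2)^-1 * 1 - s ^+ 2 * 1 + (s^-1 - s) * U = 0 -> U = - (s + s^-1).
Proof.
move=> s0 s1 skein.
have : (s ^+ 2 - 1) / s * (U + (s + s^-1)) = 0.
  by rewrite -[RHS]oppr0 -skein; field; rewrite s0.
move/eqP; rewrite mulf_eq0 mulf_eq0 invr_eq0 (negbTE s0) (negbTE s1) /=.
by rewrite addr_eq0 => /eqP.
Qed.

Lemma jones_unlink V : jones_polynomial V ->
  V (cups ++ closure true) = - (sqrt_t + sqrt_t^-1).
Proof.
move=> VJ.
have := @jones_skein V VJ [:: (0, Cup true)]%N [:: (0, Cap)]%N 0 [:: true; false] [::]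
  true false erefl erefl isT.
rewrite /smoothing /pos_crossing /neg_crossing /=.
have E e : V [:: (0, Cup true); (0, Cross e); (0, Cap)]%N = 1.
  rewrite -(jones_unknot VJ).
  by apply: (@jones_curls_cap V [:: (0, Cup true)]%N [::] 0 1).
have -> : V [:: (0, Cup true); (0, Cap); (0, Cup false); (0, Cap)]%N =
  V (cups ++ closure true).
  have -> : V [:: (0, Cup true); (0, Cap); (0, Cup false); (0, Cap)]%N =
            V [:: (0, Cup true); (0, Cap); (0, Cup true); (0, Cap)]%N.
    symmetry.
    (* A curl that can be absorbed by either the cap or the cup: absorbing it into the cup reverses
       the second circle. *)
    transitivity
      (V [:: (0, Cup true); (0, Cap); (0, Cup true); (0, Cross true); (0, Cap)]%N).
      symmetry.
      by apply: (@jones_curls_cap V [:: (0, Cup true); (0, Cap); (0, Cup true)]%N [::] 0 1).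
    by apply: (@jones_curls_cup V [:: (0, Cup true); (0, Cap)]%N [:: (0, Cap)]%N 0 1).
  symmetry.
  by apply: (@jones_move V [:: (0, Cup true)]%N [:: (0, Cap)]%N _ _ VJ
    (Exchange 0 0 Cap (Cup true))).
rewrite !E; exact: (skein_unlink sqrt_t_neq0 sqrt_t_sqr_sub1_neq0).
Qed.

Lemma link_diagram_cat A B w :
  run A [::] = Some w -> link_diagram (A ++ B) = (run B w == Some [::]).
Proof. by rewrite /link_diagram run_cat => ->. Qed.

Lemma run_braid i n e : run (nseq n (braid_pos i, Cross e)) std_state =
  Some (if odd n then if i then [:: false; true; true; false]
                      else [:: true; true; false; false] else std_state).
Proof.
case: i; first by rewrite (@run_crosses 0 _ _ [::]) //; case: odd.
by rewrite (@run_crosses 1 _ _ [:: true]) //; case: odd.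
Qed.

(** Here [i] is the parity of the number of braids in [A], so closing after one more braid uses
    [~~ i]. *)
Definition twist A i n e : diagram :=
  A ++ nseq n (braid_pos i, Cross e) ++ closure (~~ i).

Lemma twist_link A i n e : run A [::] = Some std_state -> ~~ odd n ->
  link_diagram (twist A i n e).
Proof.
move=> rA /negbTE on; rewrite (link_diagram_cat _ rA) run_cat run_braid on.
by case: i.
Qed.

(** The two strands are antiparallel, so the smoothing is a cap followed by a cup. The remaining
    crossings are curls on that cup; once they are absorbed, the cup forms a zigzag with the first
    cap of the closure and disappears, and the cap of the smoothing takes over. *)
Lemma twist_smoothing V A i n e : jones_polynomial V ->
  run A [::] = Some std_state -> odd n ->
  V (A ++ smoothing (braid_pos i) i (~~ i) ++
     nseq n (braid_pos i, Cross e) ++ closure (~~ i)) = V (A ++ closure i).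
Proof.
move=> VJ rA on; rewrite /smoothing.
have -> : i == ~~ i = false by case: i.
have rA' : run (A ++ [:: (braid_pos i, Cap)]) [::] = Some [:: true; false].
  by rewrite run_cat rA; case: i.
rewrite -[[:: _; _] ++ _]/([:: (braid_pos i, Cap)] ++
  (braid_pos i, Cup (~~ i)) :: nseq n (braid_pos i, Cross e) ++ closure (~~ i)).
rewrite catA jones_curls_cup //; last first.
  rewrite (link_diagram_cat _ rA') run_cons.
  have -> : slice_step (braid_pos i, Cup (~~ i)) [:: true; false] =
    Some (if i then [:: false; true; true; false] else [:: true; true; false; false]).
    by case: (i).
  rewrite -[obind _ (Some _)]/(run _ _) run_cat.
  case: (i); first by rewrite (@run_crosses 0 _ _ [::]) // on.
  by rewrite (@run_crosses 1 _ _ [:: true]) // on.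
rewrite on addTb negbK; case: i rA' => rA'.
  have := @jones_move V (A ++ [:: (0, Cap)]%N) [:: (0, Cap)]%N _ _ VJ (Zigzag_up 0 true).
  by rewrite !(link_diagram_cat _ rA') -!catA; apply.
have := @jones_move V (A ++ [:: (1, Cap)]%N) [:: (0, Cap)]%N _ _ VJ (Zigzag_down 0 false).
by rewrite !(link_diagram_cat _ rA') -!catA; apply.
Qed.

Lemma twist_reidemeister2 V A i n e : jones_polynomial V ->
  run A [::] = Some std_state -> ~~ odd n ->
  V (A ++ [:: (braid_pos i, Cross (~~ e))] ++
     nseq n.+1 (braid_pos i, Cross e) ++ closure (~~ i)) = V (twist A i n e).
Proof.
move=> VJ rA on; set p := braid_pos i.
have := @jones_move V A (nseq n (p, Cross e) ++ closure (~~ i)) _ _ VJ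
  (Reidemeister2 p (~~ e)).
rewrite negbK => mv; rewrite -[RHS]mv //; last exact: twist_link.
have := twist_link (~~ e) i (n := 2) rA isT.
rewrite !(link_diagram_cat _ rA) !run_cat.
have -> : run [:: (p, Cross (~~ e)); (p, Cross e)] std_state = Some std_state.
  by rewrite /p; case: (i).
by move=> _; rewrite [obind _ _]/= run_cat run_braid (negbTE on); case: (i).
Qed.

(** The skein relation is taken at the first of [n + 2] crossings: changing it leaves [n] of them by
    Reidemeister 2, smoothing it undoes the whole braid. Between antiparallel strands [Cross false]
    is the positive crossing. *)
Lemma twist_skein V A i n e : jones_polynomial V ->
  run A [::] = Some std_state -> ~~ odd n ->
  t^-1 * V (twist A i (if e then n else n.+2) e)
  - t * V (twist A i (if e then n.+2 else n) e)
  + (sqrt_t^-1 - sqrt_t) * V (A ++ closure i) = 0.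
Proof.
move=> VJ rA on.
have dp : drop (braid_pos i) std_state = [:: i, ~~ i & drop (braid_pos i).+2 std_state].
  by case: (i).
have := @jones_skein V VJ A (nseq n.+1 (braid_pos i, Cross e) ++ closure (~~ i))
  (braid_pos i) std_state _ i (~~ i) rA dp.
rewrite twist_smoothing //.
have E1 : pos_crossing (braid_pos i) i (~~ i) = (braid_pos i, Cross false) by case: (i).
have E2 : neg_crossing (braid_pos i) i (~~ i) = (braid_pos i, Cross true) by case: (i).
rewrite E1 E2.
have L f : link_diagram (A ++ [:: (braid_pos i, Cross f)] ++
    nseq n.+1 (braid_pos i, Cross e) ++ closure (~~ i)).
  have := @twist_link A i n.+2 e rA; rewrite /= negbK => /(_ on).
  by rewrite /twist !(link_diagram_cat _ rA); case: (i).
move=> /(_ (L false)); case: e {L} => /=; rewrite -(twist_reidemeister2 i _ VJ rA on) //.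
Qed.

(** The value of a 2-component unlink. *)
Definition delta (K : fieldType) (s : K) : K := - (s + s^-1).

(** With [T] the power of t for the shorter braid, two more positive crossings multiply [T] by t^2 =
    s^4. *)
Lemma skein_step_up (K : fieldType) (s T X Y W : K) : s != 0 -> s ^+ 2 + 1 != 0 ->
  (s ^+ 2)^-1 * Y - s ^+ 2 * (T * X + (1 - T) / delta s * W)
    + (s^-1 - s) * W = 0 ->
  Y = T * s ^+ 4 * X + (1 - T * s ^+ 4) / delta s * W.
Proof.
move=> s0 s1 /eqP; rewrite -addrA addr_eq0 => /eqP skein.
have -> : Y = s ^+ 2 * ((s ^+ 2)^-1 * Y) by rewrite mulVKf ?expf_neq0.
by rewrite skein /delta; field; rewrite s0 oppr_eq0 -expr2.
Qed.

Lemma skein_step_down (K : fieldType) (s T X Y W : K) : s != 0 -> s ^+ 2 + 1 != 0 ->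
  (s ^+ 2)^-1 * (T * X + (1 - T) / delta s * W) - s ^+ 2 * Y
    + (s^-1 - s) * W = 0 ->
  Y = T / s ^+ 4 * X + (1 - T / s ^+ 4) / delta s * W.
Proof.
move=> s0 s1 /eqP; rewrite addrAC subr_eq0 eq_sym => /eqP skein.
have -> : Y = (s ^+ 2)^-1 * (s ^+ 2 * Y) by rewrite mulKf ?expf_neq0.
by rewrite skein /delta; field; rewrite s0 oppr_eq0 -expr2.
Qed.

Lemma exprP_add2 (K : fieldType) (s : K) (n : nat) :
  (s ^+ 2) ^ n.+2%:Z = (s ^+ 2) ^ n%:Z * s ^+ 4.
Proof. by rewrite -!exprnP -!exprM -exprD; congr (_ ^+ _); lia. Qed.

Lemma exprN_add2 (K : fieldType) (s : K) (n : nat) :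
  (s ^+ 2) ^ (- n.+2%:Z) = (s ^+ 2) ^ (- n%:Z) / s ^+ 4.
Proof. by rewrite -!invr_expz exprP_add2 invfM. Qed.

Lemma twist_jones V A i n e : jones_polynomial V ->
  run A [::] = Some std_state -> ~~ odd n ->
  let c := if e then - n%:Z else n%:Z in
  V (twist A i n e) = t ^ c * V (A ++ closure (~~ i))
    + (1 - t ^ c) / delta sqrt_t * V (A ++ closure i).
Proof.
(* Each use of the skein relation changes the number of crossings by two, so the induction is on
   half of [n]. *)
move=> VJ rA on; rewrite -(even_halfK on) {on}.
have s0 := sqrt_t_neq0.
elim: n./2 => [|k IH].
  by case: e; rewrite /= /twist /= ?oppr0 expr0z subrr !mul0r mul1r addr0.
have := @twist_skein V A i k.*2 e VJ rA; rewrite odd_double => /(_ isT).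
have Vt : V (twist A i k.*2 e) = _ := IH.
move: Vt {IH}; rewrite doubleS /t; case: e => /= ->.
  by move/(skein_step_down s0 sqrt_t_sqr_add1_neq0) ->; rewrite -exprN_add2.
by move/(skein_step_up s0 sqrt_t_sqr_add1_neq0) ->; rewrite -exprP_add2.
Qed.

Definition alternate (b : seq int) : seq int :=
  mkseq (fun i => (-1) ^+ i * b`_i) (size b).

Lemma size_alternate b : size (alternate b) = size b.
Proof. exact: size_mkseq. Qed.

Lemma alternate_rcons b x :
  alternate (rcons b x) = rcons (alternate b) ((-1) ^+ size b * x).
Proof.
rewrite /alternate size_rcons mkseqS nth_rcons ltnn eqxx; congr rcons.
by apply/eq_in_map => i; rewrite mem_iota add0n nth_rcons => /= ->.
Qed.

Lemma alternate_cons b x : alternate (x :: b) = x :: map -%R (alternate b).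
Proof.
rewrite /alternate /mkseq /= expr0 mul1r (iotaDl 1 0) -!map_comp.
by congr cons; apply: eq_map => i /=; rewrite exprS mulN1r mulNr.
Qed.

Lemma two_bridge_braid_rcons b x : let i := odd (size b) in
  two_bridge_braid (rcons b x) = two_bridge_braid b ++
    nseq `|x|%N (braid_pos i, Cross (if i then 0 <= x else 0 <= - x)).
Proof.
rewrite /two_bridge_braid size_rcons mkseqS flatten_rcons nth_rcons ltnn eqxx.
congr (flatten _ ++ _); last by rewrite /sigma_pow abszN; case: odd.
by apply/eq_in_map => i; rewrite mem_iota add0n nth_rcons => /= ->.
Qed.

Definition open_bridge b : diagram := cups ++ two_bridge_braid b.

Lemma open_bridge_rcons b x : let i := odd (size b) in
  open_bridge (rcons b x) = open_bridge b ++
    nseq `|x|%N (braid_pos i, Cross (if i then 0 <= x else 0 <= - x)).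
Proof. by rewrite /open_bridge two_bridge_braid_rcons catA. Qed.

Lemma two_bridgeE b : two_bridge b = open_bridge b ++ closure (odd (size b)).
Proof. by rewrite /open_bridge -catA. Qed.

Lemma run_open_bridge b : all (fun x => 2 %| x)%Z b ->
  run (open_bridge b) [::] = Some std_state.
Proof.
elim/last_ind: b => [//|b x IH]; rewrite all_rcons => /andP[x2 /IH].
rewrite open_bridge_rcons run_cat => ->.
by rewrite -[obind _ _]/(run _ _) run_braid; move: x2; rewrite dvdzE dvdn2 => /negbTE ->.
Qed.

(** * Transfer matrices of 2-bridge links *)

Section Transfer.
Variables (K : fieldType) (s : K).

(** The second entry of [v] is the value of the link with the last braid removed,
    so that one step is the skein recursion. *)
Definition row_step (v : K * K) (c : int) : K * K :=
  ((s ^+ 2) ^ c * v.2 + (1 - (s ^+ 2) ^ c) / delta s * v.1, v.1).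

(** The same 2 by 2 matrix as in [row_step], now acting on columns. *)
Definition col_step (c : int) (v : K * K) : K * K :=
  ((1 - (s ^+ 2) ^ c) / delta s * v.1 + v.2, (s ^+ 2) ^ c * v.1).

Definition bridge_vec (c : seq int) : K * K := foldr col_step (1, 0) c.

(** Associativity of the matrix product: the skein recursion consumes entries from the last braid,
    whereas continued fractions unfold from the first entry. *)
Lemma foldl_row_step c v :
  (foldl row_step v c).1 = v.1 * (bridge_vec c).1 + v.2 * (bridge_vec c).2.
Proof.
elim: c v => [|x c IH] v /=; first by rewrite mulr1 mulr0 addr0.
by rewrite IH /=; ring.
Qed.

End Transfer.

(** Induction on the last braid. The first component is the skein recursion; in the second, the
    other closure puts a cap right after the last braid, whose crossings become curls. *)
Lemma jones_row V b : jones_polynomial V -> all (fun x => 2 %| x)%Z b ->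
  foldl (row_step sqrt_t) (1, delta sqrt_t) (alternate b) =
  (V (two_bridge b), V (open_bridge b ++ closure (~~ odd (size b)))).
Proof.
move=> VJ; elim/last_ind: b => [_|b x IH].
  congr pair; last by rewrite /open_bridge (jones_unlink VJ).
  rewrite -(jones_unknot VJ); symmetry.
  exact: (@jones_move V [:: (0, Cup true)]%N [:: (0, Cap)]%N _ _ VJ (Zigzag_down 1 true)).
rewrite all_rcons => /andP[x2 b2].
have rA := run_open_bridge b2.
have xn : ~~ odd `|x|%N by move: x2; rewrite dvdzE dvdn2.
have Ex : odd (size (rcons b x)) = ~~ odd (size b) by rewrite size_rcons.
rewrite alternate_rcons foldl_rcons IH //; congr pair.
  rewrite (two_bridgeE (rcons b x)) open_bridge_rcons Ex -catA.
  set i := odd (size b); set e := if i then _ else _.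
  rewrite -/(twist (open_bridge b) i _ e) (twist_jones i e VJ rA xn) -two_bridgeE.
  have -> // : (-1) ^+ size b * x = if e then - `|x|%N%:Z else `|x|%N%:Z.
  rewrite -signr_odd -/i /e; by case: (i); rewrite ?mulN1r ?mul1r; case: ifP; lia.
rewrite open_bridge_rcons Ex negbK two_bridgeE -catA; symmetry.
set i := odd (size b); set e := if i then _ else _.
have := @jones_curls_cap V (open_bridge b) [:: (0, Cap)]%N (braid_pos i) `|x|%N e VJ.
rewrite (link_diagram_cat _ rA) run_cat run_braid (negbTE xn).
by case: (i) => VE; apply: VE.
Qed.

Lemma jones_two_bridge V b : jones_polynomial V -> all (fun x => 2 %| x)%Z b ->
  let v := bridge_vec sqrt_t (alternate b) in
  V (two_bridge b) = v.1 + delta sqrt_t * v.2.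
Proof.
move=> VJ b2 v; have := foldl_row_step sqrt_t (alternate b) (1, delta sqrt_t).
by rewrite (jones_row VJ b2) mul1r.
Qed.

(** * q-rationals along Stern-Brocot words *)

(** Words act on the positive rationals from 1: [true] by x |-> x + 1 and [false] by
    x |-> x / (x + 1); [q_pair] deforms numerator and denominator. *)
Fixpoint sb_val (w : seq bool) : rat :=
  if w is o :: w' then
    if o then sb_val w' + 1 else sb_val w' / (sb_val w' + 1)
  else 1.

Fixpoint q_pair (K : fieldType) (q : K) (w : seq bool) : K * K :=
  if w is o :: w' then
    let v := q_pair q w' in
    if o then (q * v.1 + v.2, v.2) else (q * v.1, q * v.1 + v.2)
  else (1, 1).

Lemma sb_val_gt0 w : 0 < sb_val w.
Proof.
elim: w => [|[] w IH] //=; first by rewrite addr_gt0.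
by rewrite divr_gt0 // addr_gt0.
Qed.

(** Comparing the value with 1 reveals the first letter: above 1 it is [true], below 1 it is
    [false], and 1 is the empty word. *)
Lemma sb_val_inj : injective sb_val.
Proof.
have lt1 w : sb_val w / (sb_val w + 1) < 1.
  by rewrite ltr_pdivrMr ?addr_gt0 ?sb_val_gt0 // mul1r ltrDl.
have gt1 w : 1 < sb_val w + 1 by rewrite ltrDr sb_val_gt0.
elim=> [|o w IH] [|o' w'] //=.
- by case: o' => E; [have := gt1 w' | have := lt1 w']; rewrite -E ltxx.
- by case: o => E; [have := gt1 w | have := lt1 w]; rewrite E ltxx.
case: o o' => [] [] E.
- by congr cons; apply: IH; apply: addIr E.
- by have := lt_trans (lt1 w') (gt1 w); rewrite E ltxx.
- by have := lt_trans (lt1 w) (gt1 w'); rewrite E ltxx.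
congr cons; apply: IH; move/eqP: E.
have n0 v : sb_val v + 1 != 0 by rewrite gt_eqF ?addr_gt0 ?sb_val_gt0.
by rewrite eqr_div ?n0 // => /eqP; rewrite !mulrDr !mulr1 mulrC => /addrI.
Qed.

Lemma sb_val_negb w : sb_val (map negb w) = (sb_val w)^-1.
Proof.
elim: w => [|o w IH] /=; first by rewrite invr1.
have p := sb_val_gt0 w; have p0 : sb_val w != 0 by rewrite gt_eqF.
have p1 : sb_val w + 1 != 0 by rewrite gt_eqF ?addr_gt0.
have p2 : 1 + sb_val w != 0 by rewrite addrC.
by case: o; rewrite /= IH; field; rewrite ?p0 ?p1 ?p2.
Qed.

Lemma sb_val_nseq n w : sb_val (nseq n true ++ w) = n%:R + sb_val w.
Proof.
elim: n => [|n IH]; first by rewrite add0r.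
by rewrite /= IH -natr1 addrAC.
Qed.

(** The q-analogue of inversion: x |-> 1/x exchanges the two letters, and the q-deformation of 1/x
    is the inverse of that of x at 1/q. *)
Lemma q_pair_negb (K : fieldType) (q : K) w : q != 0 ->
  q_pair q (map negb w) =
    (q ^+ size w * (q_pair q^-1 w).2, q ^+ size w * (q_pair q^-1 w).1).
Proof.
move=> q0; elim: w => [|o w IH] /=; first by rewrite !mulr1.
case: o; rewrite /= IH /= exprS; congr pair.
all: by field.
Qed.

(** Adding the integer n to a q-rational: [x + n] = q^n [x] + [n], with [n] = (1 - q^n) / (1 -
    q). *)
Lemma q_pair_nseq (K : fieldType) (q : K) n w : 1 - q != 0 ->
  let v := q_pair q w in
  q_pair q (nseq n true ++ w) = (q ^+ n * v.1 + (1 - q ^+ n) / (1 - q) * v.2, v.2).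
Proof.
move=> q1 v; elim: n => [|n IH] /=.
  by rewrite expr0 mul1r subrr !mul0r addr0 -surjective_pairing.
rewrite IH /= exprS; congr pair.
by field.
Qed.

(** * Stern-Brocot words of even continued fractions *)

Fixpoint hval (c : seq int) : rat :=
  if c is x :: c' then x%:~R - (hval c')^-1 else 0.

Lemma hvalN c : hval (map -%R c) = - hval c.
Proof. by elim: c => [|x c IH] /=; rewrite ?oppr0 // IH invrN rmorphN opprD. Qed.

Lemma cf_val_alternate b : cf_val b = hval (alternate b).
Proof.
elim: b => [//|x b IH]; rewrite alternate_cons /= hvalN -IH.
by rewrite invrN opprK.
Qed.

(** Mirror symmetry: [delta] is invariant under s |-> 1/s, and t^(-c) is t^c at 1/s. *)
Lemma bridge_vecN (K : fieldType) (s : K) c :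
  bridge_vec s (map -%R c) = bridge_vec s^-1 c.
Proof.
elim: c => [//|x c IH] /=; rewrite IH /col_step.
have -> : delta s^-1 = delta s by rewrite /delta invrK addrC.
by rewrite exprVn -!exprz_inv.
Qed.

(** [2 * j] and [tau] in terms of the c_i; [p] tells whether the preceding entry is
    positive. *)
Fixpoint jexp2 (p : bool) (c : seq int) : int :=
  if c is x :: c' then
    (if 0 < x then 2 * x + (if p then -1 else 1) else -1) + jexp2 (0 < x) c'
  else 0.

Fixpoint pos_runs (p : bool) (c : seq int) : nat :=
  if c is x :: c' then addn (p && (0 < x)) (pos_runs (0 < x) c') else 0%N.

Definition q_of (K : fieldType) (s : K) : K := - (s ^+ 2)^-1.

(** Up to the factor [- s^-1], this is the sign and the power of t in the theorem. *)
Definition bridge_unit (K : fieldType) (s : K) (c : seq int) : K :=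
  (-1) ^+ (size c + pos_runs false c).+1 * s ^ (jexp2 false c - 1).

Definition nz_even (x : int) : bool := (x != 0) && (2 %| x)%Z.

Lemma sqr_inv_add1_neq0 (K : fieldType) (s : K) :
  s != 0 -> s ^+ 2 + 1 != 0 -> s^-1 ^+ 2 + 1 != 0.
Proof.
move=> s0 s1; rewrite -(inj_eq (mulfI (expf_neq0 2 s0))) mulr0 mulrDr mulr1.
by rewrite -exprMn mulfV // expr1n addrC.
Qed.

Section Steps.
Variables (K : fieldType) (s : K).
Hypotheses (s0 : s != 0) (s1 : s ^+ 2 + 1 != 0).

Lemma q_of_neq0 : q_of s != 0.
Proof. by rewrite oppr_eq0 invr_eq0 expf_neq0. Qed.

Lemma q_ofV : q_of s^-1 = (q_of s)^-1.
Proof. by rewrite /q_of exprVn invrK invrN invrK. Qed.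

Lemma one_sub_q_neq0 : 1 - q_of s != 0.
Proof.
rewrite /q_of opprK -(inj_eq (mulfI (expf_neq0 2 s0))) mulr0 mulrDr mulr1.
by rewrite mulfV ?expf_neq0.
Qed.

Lemma q_of_even n : ~~ odd n -> q_of s ^+ n = ((s ^+ 2) ^+ n)^-1.
Proof. by move=> on; rewrite exprNn -signr_odd (negbTE on) mul1r exprVn. Qed.

Lemma col_step_single n : ~~ odd n -> (0 < n)%N ->
  let u := q_pair (q_of s) (nseq n.-1 true) in
  let T := (s ^+ 2) ^+ n in
  col_step s n%:Z (1, 0) = (T * s^-1 * u.1, T * u.2).
Proof.
move=> on n0; have q0 := q_of_neq0; have q1 := one_sub_q_neq0.
have T0 : (s ^+ 2) ^+ n != 0 by rewrite !expf_neq0.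
rewrite -[nseq _ _]cats0 q_pair_nseq //= /col_step /= -exprnP.
have -> : q_of s ^+ n.-1 = ((s ^+ 2) ^+ n)^-1 / q_of s.
  by rewrite -q_of_even // -{2}(prednK n0) exprSr mulfK.
congr pair; move: ((s ^+ 2) ^+ n) T0 => T T0; rewrite /delta /q_of.
by field; rewrite s0 s1 T0 !oppr_eq0 oner_eq0 -expr2 s1.
Qed.

(** Deforms n - 1/(y + 1) = (n - 1) + y/(y + 1), where y is the value of [w]. *)
Lemma col_step_same n w l : ~~ odd n -> (0 < n)%N ->
  let v := q_pair (q_of s) (true :: w) in
  let u := q_pair (q_of s) (nseq n.-1 true ++ false :: w) in
  let m := l * ((s ^+ 2) ^+ n * s^-1) in
  col_step s n%:Z (l * s^-1 * v.1, l * v.2) = (m * s^-1 * u.1, m * u.2).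
Proof.
move=> on n0; have q0 := q_of_neq0; have q1 := one_sub_q_neq0.
have T0 : (s ^+ 2) ^+ n != 0 by rewrite !expf_neq0.
rewrite q_pair_nseq //= /col_step /= -exprnP.
have -> : q_of s ^+ n.-1 = ((s ^+ 2) ^+ n)^-1 / q_of s.
  by rewrite -q_of_even // -{2}(prednK n0) exprSr mulfK.
move: (q_pair _ w).1 (q_pair _ w).2 => p r.
congr pair; move: ((s ^+ 2) ^+ n) T0 => T T0; rewrite /delta /q_of.
  by field; rewrite s0 s1 T0 !oppr_eq0 oner_eq0 -expr2 s1.
by field; rewrite ?s0 ?s1 ?T0 ?oppr_eq0 ?oner_eq0.
Qed.

(** Deforms n + 1/y, where y is the value of [w]. The pair of a negative tail comes at 1/q;
    returning to q by [q_pair_negb] costs the power of q in [m]. *)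
Lemma col_step_opp n w l : ~~ odd n ->
  let v := q_pair (q_of s)^-1 w in
  let u := q_pair (q_of s) (nseq n true ++ map negb w) in
  let m := l * ((s ^+ 2) ^+ n * s) / q_of s ^+ size w in
  col_step s n%:Z (l * s * v.1, l * v.2) = (m * s^-1 * u.1, m * u.2).
Proof.
move=> on; have q0 := q_of_neq0; have q1 := one_sub_q_neq0.
have T0 : (s ^+ 2) ^+ n != 0 by rewrite !expf_neq0.
have k0 : q_of s ^+ size w != 0 by rewrite expf_neq0.
rewrite q_pair_nseq //= q_pair_negb // /col_step /= -exprnP (q_of_even on).
move: (q_pair _ w).1 (q_pair _ w).2 (q_of s ^+ size w) k0 => p r k k0.
congr pair; move: ((s ^+ 2) ^+ n) T0 => T T0; rewrite /delta /q_of.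
  by field; rewrite ?s0 ?s1 ?T0 ?k0 ?oppr_eq0 ?oner_eq0 -expr2 s1.
by field; rewrite ?s0 ?s1 ?T0 ?k0 ?oppr_eq0 ?oner_eq0.
Qed.

End Steps.

Lemma sign_exp_eq (K : fieldType) (s : K) (m n : nat) (i j : int) :
  odd m = odd n -> i = j -> (-1) ^+ m * s ^ i = (-1) ^+ n * s ^ j.
Proof. by move=> mn ->; rewrite -signr_odd mn signr_odd. Qed.

Lemma exp_sqr_nat (K : fieldType) (s : K) (n : nat) : (s ^+ 2) ^+ n = s ^ (2 * n%:Z).
Proof. by rewrite -exprM exprnP PoszM. Qed.

Lemma jexp2_head_pos x c : 0 < x -> jexp2 true (x :: c) = jexp2 false (x :: c) - 2.
Proof. by move=> /= ->; lia. Qed.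

Lemma pos_runs_head_pos x c : 0 < x ->
  pos_runs true (x :: c) = (pos_runs false (x :: c)).+1.
Proof. by move=> /= ->. Qed.

Lemma jexp2_head_neg p x c : x < 0 -> jexp2 p (x :: c) = jexp2 false (x :: c).
Proof. by move=> x0 /=; rewrite lt_gtF. Qed.

Lemma pos_runs_head_neg p x c : x < 0 -> pos_runs p (x :: c) = pos_runs false (x :: c).
Proof. by move=> x0 /=; rewrite lt_gtF ?andbF. Qed.

Lemma unit_same (K : fieldType) (s : K) a i j : s != 0 ->
  (-1) ^+ a * s ^ i * (s ^ j * s^-1) = (-1) ^+ a * s ^ (i + (j - 1)).
Proof. by move=> s0; rewrite !expfzDr // exprN1 !mulrA. Qed.

Lemma unit_opp (K : fieldType) (s : K) a i j k : s != 0 ->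
  (-1) ^+ a * s^-1 ^ i * (s ^ j * s) / q_of s ^+ k =
  (-1) ^+ (a + k) * s ^ (j + 1 - i + 2 * k%:Z).
Proof.
have E : (q_of s ^+ k)^-1 = (-1) ^+ k * (s ^+ 2) ^+ k.
  by rewrite -exprVn /q_of invrN invrK [LHS]exprNn.
by move=> s0; rewrite !expfzDr // E -exp_sqr_nat exprz_inv expr1z exprD; ring.
Qed.

(** The word of [c] starts with [true] because its value exceeds 1. The second and
    third clauses, relating [c] and [- c], determine the factor when the sign
    changes. *)
Definition bridge_word_spec (c : seq int) (w : seq bool) : Prop :=
  [/\ hval c = sb_val (true :: w),
      jexp2 false c + jexp2 false (map -%R c) = 2 * (size w)%:Z + 4,
      odd (size w) = odd (pos_runs false c + pos_runs false (map -%R c)) &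
      forall (K : fieldType) (s : K), s != 0 -> s ^+ 2 + 1 != 0 ->
        let v := q_pair (q_of s) (true :: w) in
        let l := bridge_unit s c in
        bridge_vec s c = (l * s^-1 * v.1, l * v.2)].

(** Of the n units, one is the value of the empty word and one is the leading [true] of the
    specification, hence [n.-2]. *)
Lemma bridge_word_single (n : nat) : (0 < n)%N -> ~~ odd n ->
  bridge_word_spec [:: n%:Z] (nseq n.-2 true).
Proof.
case: n => [|[|n]] //= _; rewrite negbK => on; split.
- rewrite /= invr0 subr0 -[nseq n true]cats0 sb_val_nseq /=.
  by rewrite -pmulrn -[n.+2]addn2 natrD addrA.
- by rewrite /= size_nseq; lia.
- by rewrite /= size_nseq (negbTE on).
move=> K s s0 s1; rewrite /= (@col_step_single K s s0 s1 n.+2) ?negbK //=.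
by rewrite /bridge_unit -signr_odd /= mul1r exp_sqr_nat addr0 addrK.
Qed.

Lemma bridge_word_same (n : nat) (x : int) c w : (0 < n)%N -> ~~ odd n -> 0 < x ->
  bridge_word_spec (x :: c) w ->
  bridge_word_spec (n%:Z :: x :: c) (nseq n.-2 true ++ false :: w).
Proof.
case: n => [|[|n]] // _; rewrite /= negbK => on x0 [Hv Hj Hp Hb].
have xN : - x < 0 by rewrite oppr_lt0.
split.
- rewrite [LHS]/= -/(hval (x :: c)) Hv /= sb_val_nseq /=.
  have p0 : sb_val w + 1 != 0 by rewrite gt_eqF ?addr_gt0 ?sb_val_gt0.
  by rewrite -pmulrn -[n.+2]addn2 natrD; field.
- rewrite [map _ _]/= -[LHS]/(2 * n.+2%:Z + 1 + jexp2 true (x :: c) +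
    (-1 + jexp2 false (map -%R (x :: c)))).
  rewrite jexp2_head_pos // size_cat size_nseq; move: Hj.
  move: (jexp2 _ _) (jexp2 _ _) => j1 j2; rewrite [size (_ :: _)]/=; lia.
- rewrite [map _ _]/= -[pos_runs _ _]/(pos_runs true (x :: c)).
  rewrite -[pos_runs _ (- n.+2%:Z :: _)]/(pos_runs false (map -%R (x :: c))).
  rewrite pos_runs_head_pos // size_cat size_nseq; move: Hp.
  by move: (pos_runs _ _) (pos_runs _ _) => k1 k2; rewrite [size (_ :: _)]/=; lia.
move=> K s s0 s1; rewrite -[bridge_vec _ _]/(col_step s n.+2%:Z (bridge_vec s (x :: c))).
rewrite Hb // (@col_step_same K s s0 s1 n.+2) ?negbK //.
suff -> : bridge_unit s [:: n.+2%:Z, x & c] =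
  bridge_unit s (x :: c) * ((s ^+ 2) ^+ n.+2 * s^-1) by [].
rewrite exp_sqr_nat /bridge_unit unit_same //.
apply: sign_exp_eq.
  rewrite -[pos_runs false (n.+2%:Z :: _)]/(pos_runs true (x :: c)).
  rewrite pos_runs_head_pos // -[size (n.+2%:Z :: _)]/(size (x :: c)).+1.
  by move: (pos_runs _ _) (size _) => k1 k2; lia.
rewrite -[jexp2 false (n.+2%:Z :: _)]/(2 * n.+2%:Z + 1 + jexp2 true (x :: c)).
by rewrite jexp2_head_pos //; move: (jexp2 _ _) => j; lia.
Qed.

Lemma bridge_word_opp (n : nat) (x : int) c w : (0 < n)%N -> ~~ odd n -> x < 0 ->
  bridge_word_spec (map -%R (x :: c)) w ->
  bridge_word_spec (n%:Z :: x :: c) (nseq n.-1 true ++ false :: map negb w).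
Proof.
case: n => [|n] // _ on x0 [Hv Hj Hp Hb].
have cK : map -%R (map -%R (x :: c)) = x :: c by rewrite mapK //; apply: opprK.
have xN : 0 < - x by rewrite oppr_gt0.
split.
- rewrite [LHS]/= -/(hval (x :: c)) -[x :: c]cK hvalN Hv.
  rewrite -[true :: nseq _ _ ++ _]/(nseq n.+1 true ++ map negb (true :: w)).
  by rewrite sb_val_nseq sb_val_negb invrN opprK -pmulrn.
- move: Hj; rewrite cK [map _ (_ :: x :: c)]/=.
  rewrite -[jexp2 _ (n.+1%:Z :: _)]/(2 * n.+1%:Z + 1 + jexp2 true (x :: c)).
  rewrite -[jexp2 _ (- n.+1%:Z :: _)]/(-1 + jexp2 false (map -%R (x :: c))).
  rewrite (jexp2_head_neg true c x0) size_cat size_nseq.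
  move: (jexp2 _ _) (jexp2 _ _) => j1 j2; rewrite [size (_ :: _)]/= size_map; lia.
- move: Hp; rewrite cK [map _ (_ :: x :: c)]/=.
  rewrite -[pos_runs _ (n.+1%:Z :: _)]/(pos_runs true (x :: c)).
  rewrite -[pos_runs _ (- n.+1%:Z :: _)]/(pos_runs false (map -%R (x :: c))).
  rewrite (pos_runs_head_neg true c x0) size_cat size_nseq; move: on.
  move: (pos_runs _ _) (pos_runs _ _) => k1 k2.
  by rewrite [size (_ :: _)]/= size_map; lia.
move=> K s s0 s1; rewrite -[bridge_vec _ _]/(col_step s n.+1%:Z (bridge_vec s (x :: c))).
have sV0 : s^-1 != 0 by rewrite invr_eq0.
have sV1 := sqr_inv_add1_neq0 s0 s1.
(* The tail is negative, so the specification is known for its negation and is applied at [s^-1]. *)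
have -> : bridge_vec s (x :: c) = bridge_vec s^-1 (map -%R (x :: c)).
  by rewrite -bridge_vecN cK.
rewrite Hb // invrK q_ofV //.
rewrite (@col_step_opp K s s0 s1 n.+1) //.
suff -> : bridge_unit s [:: n.+1%:Z, x & c] =
  bridge_unit s^-1 (map -%R (x :: c)) * ((s ^+ 2) ^+ n.+1 * s) /
  q_of s ^+ size (true :: w) by [].
rewrite exp_sqr_nat /bridge_unit unit_opp //; apply: sign_exp_eq.
  rewrite -[pos_runs false (n.+1%:Z :: _)]/(pos_runs true (x :: c)).
  rewrite (pos_runs_head_neg true c x0); move: Hp.
  rewrite cK -[size (n.+1%:Z :: _)]/(size (x :: c)).+1.
  rewrite size_map [size (true :: w)]/=.
  by move: (pos_runs _ _) (pos_runs _ _) (size (x :: c)) => k1 k2 k3; lia.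
rewrite -[jexp2 false (n.+1%:Z :: _)]/(2 * n.+1%:Z + 1 + jexp2 true (x :: c)).
rewrite (jexp2_head_neg true c x0); move: Hj; rewrite cK [size (true :: w)]/=.
by move: (jexp2 _ _) (jexp2 _ _) => j1 j2; lia.
Qed.

(** Case split on the sign of the second entry. A negative tail is negated before recursing, so the
    induction is on the length. *)
Lemma bridge_word_exists (x : int) c : 0 < x -> all nz_even (x :: c) ->
  exists w, bridge_word_spec (x :: c) w.
Proof.
have [n le_n] := ubnP (size c); elim: n => // n IH in x c le_n *.
case: x => // x x0 /= /andP[/andP[_ x2] c_even].
have xe : ~~ odd x by move: x2; rewrite dvdzE dvdn2.
case: c => [|y c] in le_n c_even *.
  by exists (nseq x.-2 true); apply: bridge_word_single.
case: (ltrgt0P y) => [y0|y0|y0].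
- have [w Hw] := IH y c le_n y0 c_even.
  by exists (nseq x.-2 true ++ false :: w); apply: bridge_word_same.
- have [|||w Hw] := IH (- y) (map -%R c).
  + by rewrite size_map.
  + by rewrite oppr_gt0.
  + move: c_even; rewrite /= all_map /nz_even oppr_eq0 rpredN => /andP[-> c_even] /=.
    by apply: sub_all c_even => z /=; rewrite oppr_eq0 rpredN.
  by exists (nseq x.-1 true ++ false :: map negb w); apply: bridge_word_opp.
by move: c_even; rewrite y0 /= .
Qed.

(** * Stern-Brocot words of positive continued fractions *)

Fixpoint cf_word (o : bool) (a : seq nat) : seq bool :=
  if a is x :: a' then nseq x o ++ cf_word (~~ o) a' else [::].

Lemma size_cf_word o a : size (cf_word o a) = sumn a.
Proof. by elim: a o => [|x a IH] o //=; rewrite size_cat size_nseq IH. Qed.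

Lemma cf_wordN o a : cf_word (~~ o) a = map negb (cf_word o a).
Proof.
by elim: a o => [|x a IH] o //=; rewrite map_cat map_nseq IH.
Qed.

(** Each block of letters adds an integer, and the alternation of blocks is the inversion of the
    tail. The last letter is dropped because the empty word already has value 1; the length is then
    the rank of the quiver. *)
Lemma cf_val_cf_word a : positive_cf a ->
  cf_val (map Posz a) = sb_val (take (sumn a).-1 (cf_word true a)).
Proof.
elim: a => [//|x a IH] /andP[_ /= /andP[x0 a0]].
have [-> /=|aN] := eqVneq a [::].
  rewrite addn0 cats0 invr0 addr0 take_nseq ?leq_pred //.
  rewrite -[nseq _ _]cats0 sb_val_nseq /= -pmulrn -{1}(prednK x0) -natr1 //.
have s0 : (0 < sumn a)%N.
  by case: (a) aN a0 => // y a' _ /= /andP[y0 _]; rewrite addn_gt0 y0.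
rewrite IH /positive_cf ?aN // (cf_wordN true).
rewrite -[in RHS](prednK s0) addnS /= take_cat size_nseq ltnNge leq_addr addKn /=.
by rewrite sb_val_nseq -map_take sb_val_negb -pmulrn.
Qed.

(** * F-polynomials of chains *)

(** [o] tells that the next vertex has an arrow to the current one. *)
Definition arrow_ok (o b b' : bool) : bool := if o then b' ==> b else b ==> b'.

Definition chain_closed (l : seq bool) (S : {set 'I_(size l).+1}) : bool :=
  [forall i : 'I_(size l),
    arrow_ok (nth true l i) (widen_ord (leqnSn _) i \in S) (lift ord0 i \in S)].

Definition set_cons n (b : bool) (S : {set 'I_n}) : {set 'I_n.+1} :=
  [set x | if unlift ord0 x is Some y then y \in S else b].

Lemma ord0_set_cons n b (S : {set 'I_n}) : (ord0 \in set_cons b S) = b.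
Proof. by rewrite inE unlift_none. Qed.

Lemma lift_set_cons n b (S : {set 'I_n}) y : (lift ord0 y \in set_cons b S) = (y \in S).
Proof. by rewrite inE liftK. Qed.

Lemma forall_ord_recl n (P : pred 'I_n.+1) :
  [forall i, P i] = P ord0 && [forall i, P (lift ord0 i)].
Proof.
apply/forallP/andP => [cl|[c0 /forallP cl] i]; first by split=> //; apply/forallP.
by case: (unliftP ord0 i) => [j|] ->.
Qed.

Lemma chain_closed_cons o l b (S : {set 'I_(size l).+1}) :
  @chain_closed (o :: l) (set_cons b S) = arrow_ok o b (ord0 \in S) && chain_closed S.
Proof.
rewrite /chain_closed forall_ord_recl lift_set_cons; congr (arrow_ok _ _ _ && _).
  by rewrite (_ : widen_ord _ _ = ord0) ?ord0_set_cons //; apply: val_inj.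
apply: eq_forallb => i; rewrite !lift_set_cons; congr arrow_ok.
rewrite (_ : widen_ord _ _ = lift ord0 (widen_ord (leqnSn _) i)).
  by rewrite lift_set_cons.
exact: val_inj.
Qed.

(** The weight [e] of the first vertex is left free: after that vertex is peeled off, the new first
    vertex has weight [q]. *)
Definition chain_wt (K : fieldType) (e q : K) (i : nat) : K := if i == 0%N then e else q.

(** The two entries of [q_pair q l] count the closed subsets containing, resp.
    avoiding, the first vertex. *)
Lemma chain_sum_fixed (K : fieldType) (e q : K) l b :
  \sum_(S : {set 'I_(size l).+1} | chain_closed S && ((ord0 \in S) == b))
    \prod_(x in S) chain_wt e q x =
  if b then e * (q_pair q l).1 else (q_pair q l).2.
Proof.
elim: l e b => [|o l IH] e b.
  pose S0 := set_cons b (set0 : {set 'I_0}).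
  rewrite (big_pred1 S0); last first.
    move=> S; rewrite [chain_closed _](_ : _ = true); last by apply/forallP=> -[].
    apply/eqP/eqP=> [Sb|->]; last exact: ord0_set_cons.
    apply/setP=> x; have -> : x = ord0 by apply: val_inj; case: x => -[].
    by rewrite Sb ord0_set_cons.
  by rewrite big_mkcond big_ord1 ord0_set_cons; case: b {S0}; rewrite ?mulr1.
rewrite (reindex_onto (@set_cons _ b)
  (fun S => [set y | lift ord0 y \in S])) /=; last first.
  move=> S /andP[_ /eqP Sb]; apply/setP=> x.
  by case: (unliftP ord0 x) => [y|] ->; rewrite ?lift_set_cons ?inE ?unlift_none.
transitivity (\sum_(S : {set 'I_(size l).+1} |
    arrow_ok o b (ord0 \in S) && chain_closed S)
   (if b then e else 1) * \prod_(x in S) chain_wt q q x).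
  apply: eq_big => S.
    rewrite chain_closed_cons ord0_set_cons eqxx andbT [_ == S](_ : _ = true) ?andbT //.
    by apply/eqP/setP=> y; rewrite inE lift_set_cons.
  move=> _; rewrite big_mkcond big_ord_recl ord0_set_cons; congr (_ * _).
  rewrite [RHS]big_mkcond; apply: eq_bigr => y _; rewrite lift_set_cons.
  by rewrite /chain_wt /=; case: eqP.
rewrite -big_distrr /=.
(* Split on membership of the second vertex; [arrow_ok] decides which cases survive. *)
rewrite (bigID (fun S : {set 'I_(size l).+1} => ord0 \in S)) /=.
have E b' : \sum_(S : {set 'I_(size l).+1} | arrow_ok o b (ord0 \in S) && chain_closed S
    && ((ord0 \in S) == b')) \prod_(x in S) chain_wt q q x =
    if arrow_ok o b b' then if b' then q * (q_pair q l).1 else (q_pair q l).2 else 0.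
  rewrite -IH; case: ifP => ok; [apply: eq_bigl | apply: big_pred0] => S;
    by case: eqP => [->|]; rewrite ?ok ?andbF.
transitivity ((if b then e else 1) *
    ((if arrow_ok o b true then q * (q_pair q l).1 else 0) +
     (if arrow_ok o b false then (q_pair q l).2 else 0))).
  rewrite -(E true) -(E false).
  by congr (_ * (_ + _)); apply: eq_bigl => S; case: (ord0 \in S); rewrite ?andbF.
by case: o b {E IH} => [] [] /=; rewrite ?mul1r ?addr0 ?add0r.
Qed.

Lemma chain_sum (K : fieldType) (e q : K) l :
  \sum_(S : {set 'I_(size l).+1} | chain_closed S) \prod_(x in S) chain_wt e q x =
  e * (q_pair q l).1 + (q_pair q l).2.
Proof.
rewrite (bigID (fun S : {set 'I_(size l).+1} => ord0 \in S)) /=.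
rewrite -(chain_sum_fixed e q l true) -(chain_sum_fixed e q l false).
by congr (_ + _); apply: eq_bigl => S; case: (ord0 \in S).
Qed.

Lemma arrow_closedE (arr : rel nat) l (S : {set 'I_(size l).+1}) :
  (forall i j, (i <= size l)%N -> (j <= size l)%N -> arr i.+1 j.+1 =
     (j == i.+1) && ~~ nth true l i || (i == j.+1) && nth true l j) ->
  [forall x in S, forall y : 'I_(size l).+1, arr x.+1 y.+1 ==> (y \in S)] =
  chain_closed S.
Proof.
move=> arrE; apply/forall_inP/forallP => [cl i | cl x xS].
  set x := widen_ord _ i; set y := lift ord0 i.
  have xy : y = x.+1 :> nat by [].
  have lx : (x <= size l)%N by rewrite -ltnS.
  have ly : (y <= size l)%N by rewrite -ltnS.
  rewrite /arrow_ok; case E: (nth true l i);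
    have Ex : nth true l x = _ := E; apply/implyP.
    move=> yS; have /forallP/(_ x)/implyP := cl y yS; apply.
    by rewrite arrE // xy eqxx Ex orbT.
  move=> xS; have /forallP/(_ y)/implyP := cl x xS; apply.
  by rewrite arrE // xy eqxx Ex.
have le_ord (z : 'I_(size l).+1) : (z <= size l)%N by rewrite -ltnS.
apply/forallP => y; apply/implyP; rewrite arrE ?le_ord //.
case/orP => /andP[/eqP xy E].
  have lt_x : (x < size l)%N by rewrite -ltnS -xy.
  have := cl (Ordinal lt_x); rewrite /arrow_ok (negbTE E) => /implyP.
  have -> : widen_ord (leqnSn _) (Ordinal lt_x) = x by apply: ord_inj.
  by have -> : lift ord0 (Ordinal lt_x) = y; [apply: ord_inj | apply].
have lt_y : (y < size l)%N by rewrite -ltnS -xy.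
have := cl (Ordinal lt_y); rewrite /arrow_ok E => /implyP.
have -> : widen_ord (leqnSn _) (Ordinal lt_y) = y by apply: ord_inj.
by have -> : lift ord0 (Ordinal lt_y) = x; [apply: ord_inj | apply].
Qed.

Lemma ell0 a : ell a 0 = 0%N.
Proof. by rewrite /ell take0. Qed.

Lemma ell_cons x a k : ell (x :: a) k.+1 = (x + ell a k)%N.
Proof. by []. Qed.

Lemma nth_cf_word o a k i : (k < size a)%N -> (ell a k <= i < ell a k.+1)%N ->
  nth true (cf_word o a) i = o (+) odd k.
Proof.
elim: a o k i => [//|x a IH] o k i.
rewrite [cf_word _ _]/= nth_cat size_nseq nth_nseq.
case: k => [_|k lt_k]; rewrite !ell_cons ?ell0.
  by rewrite addn0 => /andP[_ ->]; rewrite addbF.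
move=> /andP[le_i lt_i].
have le_xi : (x <= i)%N by apply: leq_trans le_i; rewrite leq_addr.
rewrite ltnNge le_xi /= (IH _ k) ?addNb ?addbN //.
by rewrite leq_subRL // le_i ltn_subLR.
Qed.

Lemma ell_cover a i : (i < sumn a)%N ->
  exists2 k, (k < size a)%N & (ell a k <= i < ell a k.+1)%N.
Proof.
elim: a i => [//|x a IH] i /= lt_i; have [lt_ix|le_xi] := ltnP i x.
  by exists 0%N; rewrite // ell_cons !ell0 addn0.
have [|k lt_k /andP[le_k lt]] := IH (i - x)%N; first by rewrite ltn_subLR.
exists k.+1; rewrite // !ell_cons.
by rewrite -leq_subRL // le_k -ltn_subLR.
Qed.

(** Letter i, counted from 0, orients the edge between vertices i and i + 1. Vertices are numbered
    from 1, so letter 0 belongs to no edge of the quiver. *)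
Lemma arrowE a i j : arrow a i j =
  [&& j == i.+1, i < sumn a & ~~ nth true (cf_word true a) i]%N ||
  [&& i == j.+1, j < sumn a & nth true (cf_word true a) j]%N.
Proof.
have lt_sum k n : (n < ell a k)%N -> (n < sumn a)%N.
  move/leq_trans; apply.
  by rewrite -[in X in (_ <= X)%N](cat_take_drop k a) sumn_cat leq_addr.
apply/existsP/orP => [[k]|].
  case: ifP => ok /andP[/eqP -> b]; [left|right]; rewrite eqxx /=;
  by rewrite (nth_cf_word _ _ b) // ok (lt_sum k.+1) //; case/andP: b.
case=> /and3P[/eqP -> /ell_cover[k lt_k b] l];
  exists (Ordinal lt_k); rewrite (nth_cf_word _ _ b) //= in l *;
  by case: (odd k) l; rewrite ?eqxx.
Qed.

(** Letter 0 of the word is [true] and turns the pair (p, r) of the remaining letters, those of the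
    edges, into (q p + r, r). Hence q v.1 + (1 - q) v.2 = q^2 p + r, the chain sum with first weight
    q^2. *)
Lemma F_sum (K : fieldType) (q : K) a : positive_cf a ->
  let v := q_pair q (take (sumn a).-1 (cf_word true a)) in
  \sum_(S : {set 'I_(quiver_rank a)} | closed_subset S)
    \prod_(x in S) (if val x == 0%N then q ^+ 2 else q) = q * v.1 + (1 - q) * v.2.
Proof.
move=> a_pos v.
have gen d : d = (sumn a).-1 ->
    \sum_(S : {set 'I_d} | [forall x in S, forall y : 'I_d,
        arrow a x.+1 y.+1 ==> (y \in S)])
      \prod_(x in S) (if val x == 0%N then q ^+ 2 else q) =
    q * (q_pair q (take d (cf_word true a))).1 +
    (1 - q) * (q_pair q (take d (cf_word true a))).2; last exact: gen.
(* The quiver without vertices is apart: its word is empty and both sides are 1. *)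
case: d => [_|n dE].
  rewrite take0 (big_pred1 set0).
    by rewrite big_set0 /= !mulr1 addrC subrK.
  move=> S; have -> : S = set0 by apply/setP=> -[].
  by rewrite /= eqxx; apply/forallP=> -[].
have [W' WE] : exists W', cf_word true a = true :: W'.
  case: (a) a_pos => [|x a'] /andP[_ //= /andP[x0 _]].
  by exists (nseq x.-1 true ++ cf_word false a'); rewrite -{1}(prednK x0).
have sW : size W' = n.+1.
  by have := size_cf_word true a; rewrite WE /= => E; move: dE; rewrite -E.
pose l := take n W'; have sl : size l = n by rewrite size_takel // sW.
rewrite WE -[take n.+1 _]/(true :: l) [q_pair _ _]/=.
have lE i : (i < n)%N -> nth true l i = nth true (cf_word true a) i.+1.
  by move=> lt_in; rewrite WE nth_take.
have sa : sumn a = n.+2 by rewrite -(size_cf_word true a) WE /= sW.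
clearbody l; clear dE sW WE W' v; case: n / sl sa lE => sa lE.
rewrite (eq_bigl (@chain_closed l)); last first.
  move=> S; apply: arrow_closedE => i j le_i le_j.
  rewrite arrowE sa !eqSS !ltnS le_i le_j /=.
  by congr (_ || _); case: eqP => // E; rewrite lE // -?E.
by rewrite [LHS](chain_sum (q ^+ 2) q l) /=; ring.
Qed.

(** * Exponents, signs and specializations *)

Lemma nth_alternate b i : (i < size b)%N -> (alternate b)`_i = (-1) ^+ i * b`_i.
Proof. by move=> lt_i; rewrite nth_mkseq. Qed.

Lemma all_nz_evenN c : all nz_even c -> all nz_even (map -%R c).
Proof.
by rewrite all_map; apply: sub_all => x; rewrite /nz_even /= oppr_eq0 rpredN.
Qed.

Lemma all_nz_even_alternate b : all nz_even b -> all nz_even (alternate b).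
Proof.
elim: b => [//|x b IH] /andP[x_even /IH b_even].
by rewrite alternate_cons /= x_even all_nz_evenN.
Qed.

Lemma type_seqE b : type_seq b = [seq sgz x | x <- alternate b].
Proof.
rewrite /type_seq /alternate /mkseq -map_comp; apply: eq_map => i /=.
by rewrite sgzM -signr_odd; case: odd; rewrite ?sgz1 ?sgzN1.
Qed.

Lemma tauE b : tau b = pos_runs false (alternate b).
Proof.
rewrite /tau -(size_alternate b) type_seqE; move: (alternate b) => c.
case: c => [//|x c]; elim: c x => [//|y c IH] x.
have sgz_eq1 (z : int) : (sgz z == 1) = (0 < z) by case: sgzP.
rewrite [iota _ _]/= [count _ _]/= !sgz_eq1 [RHS]/=; congr addn.
rewrite (iotaDl 1 0) count_map -[RHS]/(pos_runs false (y :: c)) -IH /=.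
by apply: eq_count.
Qed.

(** The minus sign comes from c_i c_(i-1) = - b_i b_(i-1). Since |x| >= 2, the first argument is the
    maximum exactly when x > 0. *)
Lemma jexp_term (x p : int) : nz_even x -> p != 0 ->
  2%:R * Num.max (x%:~R + (sgz (- (x * p)))%:~R / 2%:R) (- (1 / 2%:R)) =
  (if 0 < x then 2 * x + (if 0 < p then -1 else 1) else -1)%:~R :> rat.
Proof.
move=> /andP[x0 x2] p0; rewrite sgzN sgzM rmorphN rmorphM.
have : (0 < x) && (2 <= x) || (x < 0) && (x <= -2).
  by move: x0 x2; rewrite dvdzE dvdn2; lia.
case/orP => /andP[xs x_bound]; move: (x_bound); rewrite -(ler_int rat) => x_rat.
  rewrite xs (gtr0_sgz xs); case: (ltrgt0P p) p0 => // ps _.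
    rewrite (gtr0_sgz ps) max_l; last by lra.
    by rewrite rmorphD rmorphM /=; lra.
  rewrite (ltr0_sgz ps) max_l; last by lra.
  by rewrite rmorphD rmorphM /=; lra.
rewrite (ltr0_sgz xs) lt_gtF //; case: (ltrgt0P p) p0 => // ps _.
  by rewrite (gtr0_sgz ps) max_r; lra.
by rewrite (ltr0_sgz ps) max_r; lra.
Qed.

Lemma jexpE b : all nz_even b ->
  2%:R * jexp b = (jexp2 false (alternate b))%:~R.
Proof.
move=> b_even.
have gen (c : seq int) (p : int) : all nz_even c -> p != 0 ->
    2%:R * (\sum_(i < size c)
      Num.max ((c`_i)%:~R + (sgz (- (c`_i * (p :: c)`_i)))%:~R / 2%:R) (- (1 / 2%:R)))
    = (jexp2 (0 < p) c)%:~R :> rat.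
  elim: c p => [|x c IH] p; first by rewrite big_ord0 mulr0.
  move=> /= /andP[x_even c_even] p0; rewrite big_ord_recl mulrDr jexp_term //.
  by rewrite IH ?rmorphD //; case/andP: x_even.
(* The convention b_0 = 1 amounts to c_0 = -1, a negative predecessor. *)
rewrite -(gen _ (-1)) //; last exact: all_nz_even_alternate.
congr (_ * _); rewrite size_alternate; apply: eq_bigr => i _.
rewrite nth_alternate //; congr (Num.max (_ + (sgz _)%:~R / _) _).
case: i => -[|i] lt_i /=; first by rewrite mul1r mulr1 mulrN1 opprK.
rewrite nth_alternate 1?ltnW // exprS mulN1r !mulNr opprK mulrACA -expr2 -exprM.
by rewrite muln2 -signr_odd odd_double mul1r.
Qed.

Lemma t_powE (n : int) (r : rat) : 2%:R * r = n%:~R -> t_pow r = sqrt_t ^ n.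
Proof. by move=> E; rewrite /t_pow E numq_int. Qed.

Lemma F_specE a : F_spec a =
  \sum_(S : {set 'I_(quiver_rank a)} | closed_subset S)
    \prod_(x in S) (if val x == 0%N then q_of sqrt_t ^+ 2 else q_of sqrt_t).
Proof.
rewrite /F_spec /F_poly rmorph_sum; apply: eq_bigr => S _.
rewrite rmorph_prod; apply: eq_bigr => x _; rewrite /= mmapX /q_of.
by rewrite mmap1U -/t; case: ifP => // _; rewrite sqrrN exprVn.
Qed.

Lemma bar_F_specE a : bar (F_spec a) =
  \sum_(S : {set 'I_(quiver_rank a)} | closed_subset S)
    \prod_(x in S) (if val x == 0%N then (q_of sqrt_t)^-1 ^+ 2 else (q_of sqrt_t)^-1).
Proof.
rewrite F_specE (rmorph_sum bar); apply: eq_bigr => S _.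
rewrite (rmorph_prod bar); apply: eq_bigr => x _.
have E : bar (q_of sqrt_t) = (q_of sqrt_t)^-1.
  rewrite /q_of (rmorphN bar) (fmorphV bar) (rmorphXn bar) /=.
  by rewrite bar_sqrt_t invrN invrK exprVn invrK.
by case: ifP => _; rewrite -?E // (rmorphXn bar).
Qed.

(** * Comparison with the specialized F-polynomial *)

Section Assembly.
Variables (K : fieldType) (s : K).
Hypotheses (s0 : s != 0) (s1 : s ^+ 2 + 1 != 0).

Lemma exprN1z_sub m n : (-1 : K) ^ (m%:Z - n%:Z) = (-1) ^+ (m + n).
Proof.
rewrite expfzDr ?oppr_eq0 ?oner_eq0 // -[_ ^ (- n%:Z)]exprz_inv.
by rewrite invrN invr1 exprD.
Qed.

(** With u = (l s^-1 v.1, l v.2), the sum is l (s^-1 v.1 - (s + s^-1) v.2), and factoring out - s^-1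
    from [l] produces q = - s^-2. *)
Lemma bridge_value_pos c w : bridge_word_spec c w ->
  let v := q_pair (q_of s) (true :: w) in
  let u := bridge_vec s c in
  u.1 + delta s * u.2 =
  (-1) ^ ((size c)%:Z - (pos_runs false c)%:Z) * s ^ jexp2 false c *
  (q_of s * v.1 + (1 - q_of s) * v.2).
Proof.
move=> [_ _ _ /(_ K s s0 s1) /= ->] /=; rewrite exprN1z_sub /bridge_unit.
rewrite exprS mulN1r expfzDr // exprN1; move: (_ ^+ _) (_ ^ _) => e T.
rewrite /delta /q_of; move: (q_pair _ w).1 (q_pair _ w).2 => p r.
by field.
Qed.

(** The specification of the negated entries is used at [s^-1], which turns q into 1/q. The exponent
    [(size w).+2] is d + 1, as the full word [true :: w] has d letters. *)
Lemma bridge_value_neg c w : bridge_word_spec (map -%R c) w ->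
  let v := q_pair (q_of s)^-1 (true :: w) in
  let u := bridge_vec s c in
  u.1 + delta s * u.2 =
  (-1) ^ ((size c)%:Z - (pos_runs false c)%:Z) * s ^ jexp2 false c *
  (q_of s ^+ (size w).+2 * ((q_of s)^-1 * v.1 + (1 - (q_of s)^-1) * v.2)).
Proof.
have cK : map -%R (map -%R c) = c by rewrite mapK //; apply: opprK.
have sV0 : s^-1 != 0 by rewrite invr_eq0.
have sV1 := sqr_inv_add1_neq0 s0 s1.
move=> [_ Hj Hp /(_ K _ sV0 sV1) /= Hb] /=.
have -> : bridge_vec s c = bridge_vec s^-1 (map -%R c) by rewrite -bridge_vecN cK.
rewrite Hb q_ofV // exprN1z_sub /= invrK.
suff -> : bridge_unit s^-1 (map -%R c) =
  - (s * ((-1) ^+ (size c + pos_runs false c) * s ^ jexp2 false c *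
          q_of s ^+ (size w).+2)).
  move: (_ ^+ _) (_ ^ _) (q_of s ^+ _) => e T k.
  rewrite /delta /q_of; move: (q_pair _ w).1 (q_pair _ w).2 => p r.
  by field; rewrite ?s0 ?oppr_eq0 ?oner_eq0.
have qE k : q_of s ^+ k = (-1) ^+ k * s ^ (- (2 * k%:Z)).
  by rewrite -[s ^ _]exprz_inv -exp_sqr_nat exprVn /q_of [LHS]exprNn.
have -> : - (s * ((-1) ^+ (size c + pos_runs false c) * s ^ jexp2 false c *
    q_of s ^+ (size w).+2)) =
  (-1) ^+ (1 + (size c + pos_runs false c) + (size w).+2) *
  s ^ (1 + jexp2 false c - 2 * (size w).+2%:Z).
  by rewrite qE !exprD !expfzDr // expr1z expr1; ring.
rewrite /bridge_unit exprz_inv size_map; move: Hj Hp; rewrite cK.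
move: (jexp2 _ _) (jexp2 _ _) (pos_runs _ _) (pos_runs _ _) (size c) => j j' k k' m Hj Hp.
by apply: sign_exp_eq; lia.
Qed.

End Assembly.

Theorem theorem7p1 (V : diagram -> ratfun) (b : seq int) (a : seq nat) :
  jones_polynomial V ->
  even_cf b ->
  positive_cf a ->
  cf_val (map Posz a) = `|cf_val b| ->
  V (two_bridge b) =
    (-1) ^ ((size b)%:Z - (tau b)%:Z) * t_pow (jexp b) * F_even b a.
Proof.
move=> VJ /andP[b0 b_even] a_pos; rewrite (cf_val_alternate b) => ab.
have b2 : all (fun x => 2 %| x)%Z b by apply: sub_all b_even => x /andP[].
have c_even : all nz_even (alternate b) := all_nz_even_alternate b_even.
rewrite (jones_two_bridge VJ b2) (t_powE (jexpE b_even)) tauE -(size_alternate b).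
(* Both continued fractions have the same absolute value, so injectivity identifies their words. *)
have sa w : cf_val (map Posz a) = sb_val w -> take (sumn a).-1 (cf_word true a) = w.
  by rewrite cf_val_cf_word //; apply: sb_val_inj.
have d_size : (quiver_rank a).+1 = (size (take (sumn a).-1 (cf_word true a))).+1.
  by rewrite size_takel // size_cf_word leq_pred.
rewrite /F_even d_size.
move: ab; case: b b0 b_even {b2} c_even => [//|x b] _ /andP[/andP[x0 _] _].
rewrite -[(x :: b)`_0]/x alternate_cons; set c := x :: map _ _ => c_even ab.
have [x_pos|x_neg] := ltP 0 x.
  have [w Hw] := bridge_word_exists x_pos c_even.
  have [Hv _ _ _] := Hw.
  rewrite Hv gtr0_norm ?sb_val_gt0 // in ab.
  rewrite (bridge_value_pos sqrt_t_neq0 sqrt_t_sqr_add1_neq0 Hw).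
  by rewrite F_specE F_sum // (sa _ ab).
have xN : 0 < - x by rewrite oppr_gt0 lt_neqAle x0.
have [w Hw] : exists w, bridge_word_spec (map -%R c) w.
  by apply: bridge_word_exists xN _; apply: all_nz_evenN c_even.
have [Hv _ _ _] := Hw; rewrite hvalN in Hv.
rewrite -normrN Hv gtr0_norm ?sb_val_gt0 // in ab.
rewrite (bridge_value_neg sqrt_t_neq0 sqrt_t_sqr_add1_neq0 Hw).
by rewrite bar_F_specE F_sum // (sa _ ab).
Qed.
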